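(* Let $r\ge 1$ be an integer and let $\mathbb{X}\subseteq \mathbb{P}^n$ be a finite set of points having the Cayley-Bacharach property of degree $r$. If $$|\mathbb{X}|\le 5r+1,$$ then $\mathbb{X}$ lies on a plane configuration $\mathcal{P}$ of dimension $4$.
   Context: $\mathbb{P}^n$ denotes the $n$-dimensional projective space over a field $K$ of characteristic zero. Cayley-Bacharach property: for an integer $r\ge 0$, a finite set of points $\mathbb{X}\subseteq\mathbb{P}^n$ has the Cayley-Bacharach property of degree $r$ (written $\mathrm{CBP}(r)$) if every hypersurface of degree $r$ which contains all but one point of $\mathbb{X}$ must contain all the points of $\mathbb{X}$. Plane configuration: a plane configuration $\mathcal{P}$ is a union $\mathcal{P}=\bigcup_{i=1}^k\mathcal{P}_i$ of distinct positive-dimensional linear spaces $\mathcal{P}_i$ in $\mathbb{P}^n$. Its dimension is $\dim(\mathcal{P})=\sum_{i=1}^k\dim(\mathcal{P}_i)$. The set $\mathbb{X}$ lies on $\mathcal{P}$ if $\mathbb{X}\subseteq\mathcal{P}$. This statement is the case $d=4$, $r\ge 1$ of the Levinson-Ullery conjecture, which asserts: if $\mathbb{X}\subseteq\mathbb{P}^n$ is a set of points having $\mathrm{CBP}(r)$ and $|\mathbb{X}|\le (d+1)r+1$, then $\mathbb{X}$ lies on a plane configuration of dimension $d$.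
   Formalization: The theorem assumes n ≥ 2: in P^0 and P^1 no plane configuration of dimension exactly 4 exists, while e.g. the empty set or r+2 points of P^1 satisfy all the hypotheses, so the claim fails there. *)

(* Defs.v *)
From mathcomp Require Import all_boot all_order all_algebra.
From mathcomp Require Import finmap mpoly.

Set Implicit Arguments.
Unset Strict Implicit.
Unset Printing Implicit Defensive.

Import GRing.Theory.

Local Open Scope ring_scope.
Local Open Scope fset_scope.

(* Linear subspaces of P^n are vector subspaces of K^(n+1), with dimension
   shifted by one; Leibniz equality in {vspace _} is equality of subspaces. *)
Definition linear_space (K : fieldType) (n : nat) := {vspace 'rV[K]_n.+1}.

(* Both the empty space and a point have pdim 0, so 0 < pdim L says exactly
   that the projective dimension of L is positive. *)
Definition pdim (K : fieldType) (n : nat) (L : linear_space K n) : nat :=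
  (\dim L).-1.

(* The K-rational points of P^n, as lines through the origin of K^(n+1). *)
Definition point (K : fieldType) (n : nat) :=
  {p : {vspace 'rV[K]_n.+1} | \dim p == 1%N}.

Definition on_linear_space (K : fieldType) (n : nat)
    (L : linear_space K n) (p : point K n) : Prop :=
  (val p <= L)%VS.

Definition is_hypersurface (K : fieldType) (n r : nat)
    (F : {mpoly K[n.+1]}) : Prop :=
  F != 0 /\ F \is r.-homog.

Definition on_hypersurface (K : fieldType) (n : nat)
    (F : {mpoly K[n.+1]}) (p : point K n) : Prop :=
  forall v : 'rV[K]_n.+1, v \in val p -> v != 0 -> F.@[v 0] = 0.

Definition cayley_bacharach (K : fieldType) (n r : nat)
    (X : {fset point K n}) : Prop :=
  forall F : {mpoly K[n.+1]}, is_hypersurface r F ->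
  forall p : point K n, p \in X ->
  (forall q : point K n, q \in X -> q != p -> on_hypersurface F q) ->
  forall q : point K n, q \in X -> on_hypersurface F q.

(* The components are distinct because they form a finite set; one component
   may contain another. *)
Definition plane_configuration (K : fieldType) (n : nat)
    (P : {fset linear_space K n}) : Prop :=
  forall L : linear_space K n, L \in P -> (0 < pdim L)%N.

Definition config_dim (K : fieldType) (n : nat)
    (P : {fset linear_space K n}) : nat :=
  (\sum_(L <- P) pdim L)%N.

Definition lies_on (K : fieldType) (n : nat)
    (X : {fset point K n}) (P : {fset linear_space K n}) : Prop :=
  forall p : point K n, p \in X ->
  exists2 L : linear_space K n, L \in P & on_linear_space L p.

(* Main.v *)
Require Import Defs.
From mathcomp Require Import all_boot all_order all_algebra.
From mathcomp Require Import finmap mpoly zify.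

(** Testing the Cayley-Bacharach property against unions of r hyperplanes is
    enough. If a point p of X is fixed and every flat F through p satisfies
    |X ∩ F| <= r dim F + 1, the matroid union theorem in the quotient by p
    splits X \ p into r sets whose spans avoid p, so r hyperplanes separate p
    from X \ p. Hence every point of a CB(r) set X lies on a dense flat F,
    one of positive dimension with |X ∩ F| >= r dim F + 2. Moreover, removing
    a flat from a CB(r) set leaves a CB(r - 1) set. Together these bound the
    plane configurations covering at most k r + 1 points, for k = 2, 3, 4 and
    then 5: a dense flat of large dimension leaves few points, while dense
    lines are disjoint unless their joins are dense. When |X| <= 5 r + 1, the
    only remaining case consists of two dense planes A, B with 2 r + 2 points
    each, meeting in a line L with r + 3 points; then the points off A + B lie
    in a plane P, and X lies on L and the span of P and a point of A. *)

Set Implicit Arguments.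
Unset Strict Implicit.
Unset Printing Implicit Defensive.

Import GRing.Theory.

Local Open Scope ring_scope.

(** * Spans of finite point sets *)

Section PointConfigurations.

Variables (K : fieldType) (V : vectType K) (T : finType).
Variable l : T -> {vspace V}.
Hypothesis l_inj : injective l.
Hypothesis dim_l : forall t, \dim (l t) = 1%N.

Definition flat_span (S : {set T}) : {vspace V} := (\sum_(t in S) l t)%VS.

Lemma sub_flat_span (S : {set T}) t : t \in S -> (l t <= flat_span S)%VS.
Proof. by move=> tS; apply: (sumv_sup t). Qed.

Lemma flat_span_subP (S : {set T}) (U : {vspace V}) :
  reflect (forall t, t \in S -> (l t <= U)%VS) (flat_span S <= U)%VS.
Proof. exact: subv_sumP. Qed.

Lemma flat_spanS (A B : {set T}) : A \subset B -> (flat_span A <= flat_span B)%VS.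
Proof.
by move=> /subsetP sAB; apply/flat_span_subP => t /sAB; apply: sub_flat_span.
Qed.

Lemma flat_spanU (A B : {set T}) :
  flat_span (A :|: B) = (flat_span A + flat_span B)%VS.
Proof.
apply: subv_anti; apply/andP; split.
  apply/flat_span_subP => t; rewrite inE => /orP[] /sub_flat_span st.
    exact: subv_trans st (addvSl _ _).
  exact: subv_trans st (addvSr _ _).
by rewrite subv_add !flat_spanS ?subsetUl ?subsetUr.
Qed.

Lemma flat_span_submod (W : {vspace V}) (A B : {set T}) :
  (\dim (W + flat_span (A :|: B)) + \dim (W + flat_span (A :&: B))
     <= \dim (W + flat_span A) + \dim (W + flat_span B))%N.
Proof.
rewrite -(dimv_sum_cap (W + flat_span A)).
have -> : (W + flat_span (A :|: B) =
           W + flat_span A + (W + flat_span B))%VS.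
  by rewrite flat_spanU -{1}(addvv W) Monoid.mulmACA.
by rewrite leq_add2l dimvS // subv_cap !addvS ?flat_spanS ?subsetIl ?subsetIr.
Qed.

(** * Matroid union in quotients by subspaces *)

Section MatroidUnion.

Variable I : finType.
Implicit Types (W : I -> {vspace V}) (E S : {set T}).

Let total W S := (\sum_i \dim (W i + flat_span S))%N.
Let base W := (\sum_i \dim (W i))%N.

Lemma total_submod W A B :
  (total W (A :|: B) + total W (A :&: B) <= total W A + total W B)%N.
Proof.
by rewrite -!big_split leq_sum // => i _; apply: flat_span_submod.
Qed.

Definition add_at W (i : I) (L : {vspace V}) : I -> {vspace V} :=
  fun j => if j == i then (W i + L)%VS else W j.

(* Rado's condition for the matroids [S |-> dim (W i + S) - dim (W i)]. *)
Definition rado W E := [forall S : {set T},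
  (S \subset E) ==> (#|S| + base W <= total W S)%N].

(* If x cannot be added to any of the parts, each part yields a tight set
   spanning x; tight sets are closed under union, so a largest one spans x in
   every part and contradicts Rado's condition. *)
Lemma rado_step W E x : x \in E -> rado W E ->
  exists2 i, ~~ (l x <= W i)%VS & rado (add_at W i (l x)) (E :\ x).
Proof.
move=> xE /forallP radoW.
have radoS S : S \subset E -> (#|S| + base W <= total W S)%N.
  by move=> sSE; move/implyP: (radoW S); apply.
have [/existsP[i /andP[]]|/existsPn noi] :=
    boolP [exists i, ~~ (l x <= W i)%VS && rado (add_at W i (l x)) (E :\ x)].
  by exists i.
exfalso.
pose tight S := (S \subset E :\ x) && (total W S == #|S| + base W)%N.
have subE S : S \subset E :\ x -> S \subset E.
  by move=> /subset_trans; apply; rewrite subD1set.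
have tight0 : tight set0.
  rewrite /tight sub0set cards0 add0n; apply/eqP; apply: eq_bigr => i _.
  by rewrite /flat_span big_set0 addv0.
have tightU A B : tight A -> tight B -> tight (A :|: B).
  move=> /andP[sA /eqP tA] /andP[sB /eqP tB].
  have sAB : A :|: B \subset E :\ x by rewrite subUset sA.
  rewrite /tight sAB eqn_leq radoS ?subE // andbT.
  have := total_submod W A B; rewrite tA tB.
  have := radoS (A :&: B) (subE _ (subset_trans (subsetIl _ _) sA)).
  have := cardsUI A B; lia.
have [M tM maxM] := arg_maxnP (fun S : {set T} => #|S|) tight0.
have tight_sub S : tight S -> S \subset M.
  move=> tS; have /maxM := tightU _ _ tS tM => leM.
  have /eqP -> : M == S :|: M by rewrite eqEcard subsetUr.
  exact: subsetUl.
have spanM i : (l x <= W i + flat_span M)%VS.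
  have := noi i; rewrite negb_and negbK => /orP[lxW|].
    exact: subv_trans lxW (addvSl _ _).
  move=> /forallPn[S]; rewrite negb_imply -ltnNge => /andP[sS].
  set W' := add_at W i (l x).
  have baseE : base W' = (\dim (W i + l x) + \sum_(j | j != i) \dim (W j))%N.
    rewrite /base (bigD1 i) //= /W' /add_at eqxx; congr (_ + _)%N.
    by apply: eq_bigr => j /negPf ->.
  have totalE : total W' S = (\dim (W i + l x + flat_span S)
      + \sum_(j | j != i) \dim (W j + flat_span S))%N.
    rewrite /total (bigD1 i) //= /W' /add_at eqxx; congr (_ + _)%N.
    by apply: eq_bigr => j /negPf ->.
  have dimD := leq_of_leqif (dimv_add_leqif (W i) (l x)).
  have le : (W i + flat_span S <= W i + l x + flat_span S)%VS.
    by apply: addvS; rewrite ?addvSl.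
  have := radoS _ (subE _ sS); move: dimD; rewrite baseE totalE dim_l.
  have baseWE : base W = (\dim (W i) + \sum_(j | j != i) \dim (W j))%N.
    exact: bigD1.
  have totalWE : total W S = (\dim (W i + flat_span S)
      + \sum_(j | j != i) \dim (W j + flat_span S))%N by exact: bigD1.
  rewrite totalWE baseWE.
  (* If [l x] were outside [W i + flat_span S], adding it would raise [total] by at least 1, the
     most that [base] can gain, and [S] would not violate Rado's condition. *)
  have [sub dimD leS ltS|nsub] := boolP (l x <= W i + flat_span S)%VS;
    last first.
    have : (\dim (W i + flat_span S) < \dim (W i + l x + flat_span S))%N.
      rewrite (ltn_leqif (dimv_leqif_sup le)); apply: contra nsub.
      exact/subv_trans/subv_trans/addvSl/addvSr.
    lia.
  apply: subv_trans sub (addvS (subvv _) (flat_spanS (tight_sub _ _))).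
  rewrite /tight sS totalWE baseWE; apply/eqP; have := dimvS le; lia.
have sxM : x |: M \subset E.
  by case/andP: tM => /subE sM _; rewrite subUset sub1set xE.
have := radoS _ sxM.
have -> : total W (x |: M) = total W M.
  apply: eq_bigr => i _; congr (\dim _); rewrite flat_spanU.
  rewrite {1}/flat_span big_set1; apply/eqP.
  rewrite Monoid.mulmCA eqEsubv addvSr andbT.
  by rewrite subv_add spanM /=.
case/andP: tM => sM /eqP ->; rewrite cardsU1.
have -> : x \notin M.
  by apply/negP => /(subsetP sM); rewrite !inE eqxx.
lia.
Qed.

(* Matroid union theorem (Edmonds, Rado-Horn). *)
Lemma rado_partition W E : rado W E ->
  exists2 D : I -> {set T}, E \subset \bigcup_i D i
    & forall i, (#|D i| + \dim (W i) <= \dim (W i + flat_span (D i)))%N.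
Proof.
elim: {E}#|E| {-2}E (erefl #|E|) W => [|m IH] E cardE W radoW.
  exists (fun=> set0); first by rewrite (cards0_eq cardE) sub0set.
  by move=> i; rewrite cards0 dimvS ?addvSl.
have [x xE] : exists x, x \in E by apply/card_gt0P; rewrite cardE.
have [i lxW radoW'] := rado_step xE radoW.
have [|D sED dimD] := IH (E :\ x) _ _ radoW'.
  by move: cardE; rewrite (cardsD1 x) xE => -[].
exists (fun j => if j == i then x |: D j else D j).
  apply/subsetP => y yE; apply/bigcupP.
  have [->|yx] := eqVneq y x; first by exists i; rewrite ?eqxx ?setU11.
  have /(subsetP sED)/bigcupP[j _ yD] : y \in E :\ x by rewrite !inE yx.
  by exists j => //; case: ifP; rewrite // inE yD orbT.
move=> j; have := dimD j; rewrite /add_at; case: eqP => [->|//].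
rewrite flat_spanU {2}/flat_span big_set1 addvA => le.
apply: leq_trans le; rewrite cardsU1.
have : (\dim (W i) < \dim (W i + l x))%N.
  rewrite (ltn_leqif (dimv_leqif_sup (addvSl _ _))).
  by apply: contra lxW; apply: subv_trans (addvSr _ _).
by case: (_ \notin _); lia.
Qed.

End MatroidUnion.

(** * Dense flats of Cayley-Bacharach sets *)

Implicit Types (Y Z : {set T}) (U : {vspace V}).

Definition on_flat U : {set T} := [set t | (l t <= U)%VS].

Lemma dim_flat_span S : (\dim (flat_span S) <= #|S|)%N.
Proof.
apply: leq_trans (dimv_leq_sum _ _ _) _.
by rewrite -sum1_card leq_sum // => i; rewrite dim_l.
Qed.

(* The Cayley-Bacharach property for unions of r hyperplanes, each of them
   replaced by an arbitrary flat. *)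
Definition flat_cb r Y := forall p, p \in Y ->
  forall s : seq {vspace V}, (size s <= r)%N ->
  (forall y, y \in Y -> y != p -> has (fun U => (l y <= U)%VS) s) ->
  has (fun U => (l p <= U)%VS) s.

(** A cover of the other remaining points by [r.-1] flats becomes, with [U] added, a cover by [r]
    flats, and [U] misses p. *)
Lemma flat_cb_excise r Y U : (0 < r)%N -> flat_cb r Y ->
  flat_cb r.-1 (Y :\: on_flat U).
Proof.
move=> r_gt0 cbY p; rewrite !inE => /andP[npU pY] s les cov.
have := cbY p pY (U :: s); rewrite /= (negPf npU) /=; apply; first by lia.
move=> y yY yp; have [//|nyU] := boolP (l y <= U)%VS.
by apply: cov => //; rewrite !inE nyU.
Qed.

Lemma flat_cb_dense r Y p : flat_cb r Y -> p \in Y ->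
  exists2 U, (l p <= U)%VS & (r * (\dim U).-1 + 2 <= #|Y :&: on_flat U|)%N.
Proof.
move=> cbY pY; pose W (_ : 'I_r) := l p.
have sum_r (c : nat) : (\sum_(i < r) c = r * c)%N.
  by rewrite sum_nat_const card_ord.
have [radoW|] := boolP (rado W (Y :\ p)); last first.
  (* A violating [S] has [r * \dim (l p + flat_span S) < #|S| + r]; p itself supplies the second
     unit of [+ 2]. *)
  move=> /forallPn[S]; rewrite negb_imply -ltnNge => /andP[sS].
  rewrite /W !sum_r dim_l => lt; exists (l p + flat_span S)%VS.
    exact: addvSl.
  have : (#|p |: S| <= #|Y :&: on_flat (l p + flat_span S)|)%N.
    apply/subset_leq_card/subsetP => t; rewrite !inE => /orP[/eqP ->|tS].
      by rewrite pY addvSl.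
    have /(subsetP sS) := tS; rewrite !inE => /andP[_ ->] /=.
    exact: subv_trans (sub_flat_span tS) (addvSr _ _).
  rewrite cardsU1; have -> : p \notin S.
    by apply/negP => /(subsetP sS); rewrite !inE eqxx.
  have : (0 < \dim (l p + flat_span S))%N.
    by rewrite -(dim_l p) dimvS ?addvSl.
  move: lt; case: (\dim _) => [//|m] /=; nia.
(* The spans of the [D i] cover all points but p, so one of them contains p; its dimension would
   then be at least [#|D i| + 1], which is impossible. *)
have [D sYD dimD] := rado_partition radoW.
have /hasP[_ /mapP[i _ ->] /addv_idPr eqD] :
    has (fun U => (l p <= U)%VS) [seq flat_span (D i) | i <- enum 'I_r].
  apply: cbY; rewrite ?size_map -?enumT ?size_enum_ord // => y yY yp.
  have /(subsetP sYD)/bigcupP[i _ yD] : y \in Y :\ p by rewrite !inE yp.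
  rewrite has_map; apply/hasP; exists i; rewrite -?enumT ?mem_enum //=.
  exact: sub_flat_span.
by have := dimD i; have := dim_flat_span (D i); rewrite /W eqD dim_l; lia.
Qed.

Lemma card_on_flatD Y U :
  (#|Y :\: on_flat U| + #|Y :&: on_flat U| = #|Y|)%N.
Proof. by rewrite addnC cardsID. Qed.

Lemma on_flatI U W : on_flat (U :&: W) = on_flat U :&: on_flat W.
Proof. by apply/setP => t; rewrite !inE subv_cap. Qed.

Lemma on_flatS U W : (U <= W)%VS -> on_flat U \subset on_flat W.
Proof.
by move=> sUW; apply/subsetP => t; rewrite !inE => /subv_trans; apply.
Qed.

Lemma card_on_point Y U : (\dim U <= 1)%N -> (#|Y :&: on_flat U| <= 1)%N.
Proof.
move=> dimU; apply/card_le1_eqP => s t.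
rewrite !inE => /andP[_ sU] /andP[_ tU]; apply: l_inj.
have eqU x : (l x <= U)%VS -> l x = U.
  by move=> xU; apply/eqP; rewrite eqEdim xU dim_l.
by rewrite (eqU s sU) (eqU t tU).
Qed.

Lemma card_on_join Y U W :
  (#|Y :&: on_flat U| + #|Y :&: on_flat W|
     <= #|Y :&: on_flat (U + W)| + #|Y :&: on_flat (U :&: W)|)%N.
Proof.
rewrite on_flatI setIIr -cardsUI leq_add2r subset_leq_card //.
by rewrite -setIUr setIS // subUset !on_flatS ?addvSl ?addvSr.
Qed.

Lemma dim_join_meet U W t : (l t <= U)%VS -> (l t <= W)%VS ->
  (\dim (U + W) < \dim U + \dim W)%N.
Proof.
move=> tU tW; rewrite -(dimv_sum_cap U W) -addn1 leq_add2l -(dim_l t).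
by rewrite dimvS // subv_cap tU.
Qed.

Lemma dim_cap_proper U W t : (l t <= W)%VS -> ~~ (l t <= U)%VS ->
  (\dim (U :&: W) < \dim W)%N.
Proof.
move=> tW ntU; rewrite (ltn_leqif (dimv_leqif_sup (capvSr _ _))).
by apply: contra ntU => sWU; apply: subv_trans tW (subv_trans sWU (capvSl _ _)).
Qed.

Lemma flat_cb_dense_dim r Y p : flat_cb r Y -> p \in Y ->
  exists e U, [/\ \dim U = e.+2, (l p <= U)%VS
    & (r * e.+1 + 2 <= #|Y :&: on_flat U|)%N].
Proof.
move=> cbY pY; have [U pU dU] := flat_cb_dense cbY pY.
case dimU: (\dim U) dU => [|[|e]] dU; last by exists e, U.
- by have := dimvS pU; rewrite dimU dim_l.
by have := @card_on_point Y U; rewrite dimU => /(_ isT); lia.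
Qed.

Lemma flat_cb_empty r Y : flat_cb r Y -> (#|Y| <= r.+1)%N -> Y = set0.
Proof.
move=> cbY leY; have [//|[p pY]] := set_0Vmem Y.
have [e [U [_ _ dU]]] := flat_cb_dense_dim cbY pY.
have := card_on_flatD Y U; nia.
Qed.

(** The points off [U] satisfy [flat_cb r.-1]; were there any, a dense flat would hold at least
    [r + 1] of them. *)
Lemma flat_cb_sub_flat r Y U : (0 < r)%N -> flat_cb r Y ->
  (#|Y :\: on_flat U| <= r)%N -> Y \subset on_flat U.
Proof.
move=> r_gt0 cbY le; rewrite -setD_eq0; apply/eqP.
apply: (@flat_cb_empty r.-1); first exact: flat_cb_excise.
by rewrite prednK.
Qed.

Lemma flat_cb_collinear r Y : flat_cb r Y -> (#|Y| <= 2 * r + 1)%N ->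
  exists2 U, (\dim U <= 2)%N & Y \subset on_flat U.
Proof.
move=> cbY leY; have [->|[p pY]] := set_0Vmem Y.
  by exists 0%VS; rewrite ?dimv0 ?sub0set.
have [e [U [dimU _ dU]]] := flat_cb_dense_dim cbY pY.
have cardY := card_on_flatD Y U.
have e0 : e = 0%N by nia.
rewrite {}e0 in dimU dU.
exists U; first by rewrite dimU.
by apply: flat_cb_sub_flat cbY _; lia.
Qed.

Lemma flat_cb_coplanar r Y : (0 < r)%N -> flat_cb r Y -> (#|Y| <= 2 * r + 2)%N ->
  exists2 U, (\dim U <= 3)%N & Y \subset on_flat U.
Proof.
move=> r_gt0 cbY leY; have [->|[p pY]] := set_0Vmem Y.
  by exists 0%VS; rewrite ?dimv0 ?sub0set.
have [e [U [dimU _ dU]]] := flat_cb_dense_dim cbY pY.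
have cardY := card_on_flatD Y U.
have e1 : (e <= 1)%N by nia.
exists U; first by rewrite dimU.
by apply: flat_cb_sub_flat cbY _; nia.
Qed.

(** * Covers by flats of bounded total dimension *)

Hypothesis dimV : (1 < \dim {:V})%N.

(** Repetitions are allowed and [d] is only an upper bound, which suits induction;
    [exact_configuration] restores distinctness and the exact dimension. *)
Definition covered d Y := exists s : seq {vspace V},
  [/\ all (fun U => 1 < \dim U)%N s, (\sum_(U <- s) (\dim U).-1 <= d)%N
    & forall y, y \in Y -> has (fun U => (l y <= U)%VS) s].

Lemma covered0 d : covered d set0.
Proof. by exists [::]; split=> // [|y]; rewrite ?big_nil ?inE. Qed.

Lemma enlarge_flat U m : (\dim U <= m)%N -> (m <= \dim {:V})%N ->
  exists2 W, (U <= W)%VS & \dim W = m.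
Proof.
elim: m => [|m IH] leU lem.
  by exists U => //; apply/eqP; rewrite -leqn0.
have [eqU|neU] := eqVneq (\dim U) m.+1; first by exists U.
have [|W sUW dimW] := IH _ (ltnW lem); first by lia.
have /subvPn[v _ nvW] : ~~ (fullv <= W)%VS.
  by apply/negP => /dimvS; rewrite dimW leqNgt lem.
exists (W + <[v]>)%VS; first exact: subv_trans sUW (addvSl _ _).
have nz_v : v != 0 by apply: contraNneq nvW => ->; rewrite mem0v.
have := dimv_add_leqif W <[v]>; move/leq_of_leqif; rewrite dimW dim_vline nz_v.
have : (\dim W < \dim (W + <[v]>))%N.
  rewrite (ltn_leqif (dimv_leqif_sup (addvSl _ _))).
  by apply: contra nvW => sW; rewrite memvE (subv_trans (addvSr _ _) sW).
by rewrite dimW; lia.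
Qed.

Lemma covered_flat U d e Y : (0 < d)%N -> (\dim U <= d.+1)%N ->
  covered e (Y :\: on_flat U) -> covered (d + e) Y.
Proof.
move=> d_gt0 dimU [s [s_gt1 sum_s cov]].
(* A point or the empty space is no admissible component; a line containing it costs 1, which
   [0 < d] pays for. *)
have [W sUW /andP[W_gt1 W_le]] : exists2 W, (U <= W)%VS & (1 < \dim W <= d.+1)%N.
  have [gt1|lt] := ltnP 1 (\dim U); first by exists U; rewrite ?gt1.
  by have [W sUW dimW] := enlarge_flat (leqW lt) dimV; exists W; rewrite ?dimW ?ltnS.
exists (W :: s); split=> /=; rewrite ?W_gt1 //.
  by rewrite big_cons; lia.
move=> y yY; have [yU|nyU] := boolP (l y <= U)%VS.
  by rewrite (subv_trans yU).
by rewrite cov ?orbT // !inE nyU.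
Qed.

Lemma covered_le d e Y : (d <= e)%N -> covered d Y -> covered e Y.
Proof.
by move=> le [s [? le' cov]]; exists s; split=> //; apply: leq_trans le' le.
Qed.

Lemma covered_sub_flat U d Y : (0 < d)%N -> (\dim U <= d.+1)%N ->
  Y \subset on_flat U -> covered d Y.
Proof.
move=> d_gt0 dimU; rewrite -setD_eq0 => /eqP YD.
rewrite -(addn0 d); apply: covered_flat dimU _ => //; rewrite YD.
exact: covered0.
Qed.

(* Two dense lines through a common point would span a plane with 2r + 3
   points, so the dense lines are disjoint. *)
Lemma covered_lines r d Z :
  (forall p, p \in Z -> exists U, [/\ (\dim U <= 2)%N, (l p <= U)%VS
     & (r + 2 <= #|Z :&: on_flat U|)%N]) ->
  (forall U, (\dim U <= 3)%N -> (#|Z :&: on_flat U| <= 2 * r + 2)%N) ->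
  (#|Z| < d.+1 * (r + 2))%N -> covered d Z.
Proof.
elim: d Z => [|d IH] Z dense plane ltZ; have [->|[p pZ]] := set_0Vmem Z;
  do ?exact: covered0.
  have [U [_ _ le]] := dense p pZ.
  by have := card_on_flatD Z U; lia.
have [U [dimU pU denseU]] := dense p pZ.
rewrite -add1n; apply: (covered_flat _ dimU) => //; apply: IH.
- move=> q; rewrite !inE => /andP[nqU qZ].
  have [W [dimW qW denseW]] := dense q qZ; exists W; split=> //.
  apply: (leq_trans denseW); apply/subset_leq_card/subsetP => t.
  rewrite !inE => /andP[tZ tW]; rewrite tZ tW !andbT; apply/negP => tU.
  have ltUW := dim_join_meet tU tW; have ltW := dim_cap_proper qW nqU.
  have := @card_on_join Z U W.
  have /(card_on_point Z) : (\dim (U :&: W) <= 1)%N by lia.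
  have /plane : (\dim (U + W) <= 3)%N by lia.
  lia.
- move=> W /plane; apply: leq_trans; apply: subset_leq_card.
  by apply: setSI; apply: subsetDl.
by have := card_on_flatD Z U; lia.
Qed.

Lemma covered_split U d e r Y : (0 < d)%N -> (0 < r)%N -> (\dim U <= d.+1)%N ->
  flat_cb r Y ->
  (flat_cb r.-1 (Y :\: on_flat U) -> covered e (Y :\: on_flat U)) ->
  covered (d + e) Y.
Proof.
move=> d_gt0 r_gt0 dimU cbY cov; apply: (covered_flat d_gt0 dimU).
by apply: cov; apply: flat_cb_excise.
Qed.

Lemma flat_cb_covered1 r Y : flat_cb r Y -> (#|Y| <= 2 * r + 1)%N -> covered 1 Y.
Proof.
move=> cbY leY; have [U dimU sub] := flat_cb_collinear cbY leY.
exact: (@covered_sub_flat U 1).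
Qed.

(* It suffices to test the finitely many flats spanned by points. *)
Lemma flat_dec (Q : pred {set T}) m :
  (exists2 U, (\dim U <= m)%N & Q (on_flat U))
    \/ (forall U, (\dim U <= m)%N -> ~~ Q (on_flat U)).
Proof.
have [/existsP[S /andP[dimS QS]]|/existsPn no] :=
    boolP [exists S, (\dim (flat_span S) <= m)%N && Q (on_flat (flat_span S))].
  by left; exists (flat_span S).
right=> U dimU; have := no (on_flat U).
have sU : (flat_span (on_flat U) <= U)%VS.
  by apply/flat_span_subP => t; rewrite inE.
rewrite (leq_trans (dimvS sU) dimU) /=.
have -> // : on_flat (flat_span (on_flat U)) = on_flat U.
apply/eqP; rewrite eqEsubset on_flatS //=.
by apply/subsetP => t tU; rewrite inE sub_flat_span.
Qed.

(** A plane with [2 * r + 2] points leaves at most [r - 1], hence none. Without such a plane every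
    dense flat is a line, since larger ones need [3 * r + 2] points. *)
Lemma flat_cb_covered2 r Y : flat_cb r Y -> (#|Y| <= 3 * r + 1)%N -> covered 2 Y.
Proof.
move=> cbY leY.
have [[U dimU dU]|noplane] :=
    flat_dec (fun S => 2 * r + 2 <= #|Y :&: S|)%N 3.
  have cardY := card_on_flatD Y U.
  apply: (covered_sub_flat _ dimU) => //.
  by apply: flat_cb_sub_flat cbY _; lia.
apply: (@covered_lines r); last lia.
- move=> p pY; have [e [U [dimU pU dU]]] := flat_cb_dense_dim cbY pY.
  have cardY := card_on_flatD Y U; exists U; split=> //.
    rewrite dimU; case: e => [//|e] in dimU dU *.
    case: e => [|e] in dimU dU *; last by nia.
    by have := noplane U; rewrite dimU => /(_ isT); lia.
  by nia.
- by move=> U /noplane; lia.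
Qed.

(** A plane with [2 * r + 2] points leaves at most [2 * (r - 1) + 1], which lie on a line; a solid
    with [3 * r + 2] leaves none. Otherwise every dense flat is a line. *)
Lemma flat_cb_covered3 r Y : flat_cb r Y -> (#|Y| <= 4 * r + 1)%N -> covered 3 Y.
Proof.
move=> cbY leY.
have [[U dimU dU]|noplane] :=
    flat_dec (fun S => 2 * r + 2 <= #|Y :&: S|)%N 3.
  have cardY := card_on_flatD Y U; have r_gt0 : (0 < r)%N by lia.
  apply: (@covered_split U 2 1 r) => // cbZ.
  by apply: flat_cb_covered1 cbZ _; lia.
have [[U dimU dU]|nosolid] :=
    flat_dec (fun S => 3 * r + 2 <= #|Y :&: S|)%N 4.
  have cardY := card_on_flatD Y U.
  apply: (covered_sub_flat _ dimU) => //.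
  by apply: flat_cb_sub_flat cbY _; lia.
apply: (@covered_lines r); last lia.
- move=> p pY; have [e [U [dimU pU dU]]] := flat_cb_dense_dim cbY pY.
  have cardY := card_on_flatD Y U; exists U; split=> //.
    rewrite dimU; case: e => [//|e] in dimU dU *.
    case: e => [|e] in dimU dU *.
      by have := noplane U; rewrite dimU => /(_ isT); lia.
    case: e => [|e] in dimU dU *; last by nia.
    by have := nosolid U; rewrite dimU => /(_ isT); lia.
  by nia.
- by move=> U /noplane; lia.
Qed.

(* The hypotheses are the equality case of the inequalities in
   [flat_cb_covered4]; \dim is the vector space dimension, so A and B are
   planes and A + B is a solid. *)
Lemma flat_cb_two_planes r Y A B : (1 < r)%N -> flat_cb r Y ->
  (#|Y| <= 5 * r + 1)%N -> (\dim A <= 3)%N -> (\dim B <= 3)%N ->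
  (\dim (A :&: B) <= 2)%N -> (\dim (A + B) <= 4)%N ->
  #|Y :&: on_flat A| = (2 * r + 2)%N -> #|Y :&: on_flat B| = (2 * r + 2)%N ->
  #|Y :&: on_flat (A :&: B)| = (r + 3)%N ->
  #|Y :&: on_flat (A + B)| = (3 * r + 1)%N ->
  covered 4 Y.
Proof.
move=> r_gt1 cbY leY dimA dimB dimL dimS cA cB cL cS.
have r_gt0 : (0 < r)%N by lia.
have cardL := card_on_flatD (Y :&: on_flat A) (A :&: B)%VS.
(* At most [2 * r = 2 * r.-1 + 2] points lie off [A + B]. *)
have [P dimP sP] : exists2 P, (\dim P <= 3)%N
    & Y :\: on_flat (A + B) \subset on_flat P.
  apply: (@flat_cb_coplanar r.-1); first lia; first exact: flat_cb_excise.
  by have := card_on_flatD Y (A + B)%VS; lia.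
have capA : (Y :&: on_flat A) :&: on_flat (A :&: B) = Y :&: on_flat (A :&: B).
  by rewrite -setIA (setIidPr (on_flatS (capvSl A B))).
have capB : (Y :&: on_flat B) :&: on_flat (A :&: B) = Y :&: on_flat (A :&: B).
  by rewrite -setIA (setIidPr (on_flatS (capvSr A B))).
have cardB := card_on_flatD (Y :&: on_flat B) (A :&: B)%VS.
rewrite capA in cardL; rewrite capB in cardB.
set L := (A :&: B)%VS in dimL cL cardL capA cardB capB *.
have [a] : exists a, a \in (Y :&: on_flat A) :\: on_flat L.
  by apply/card_gt0P; lia.
rewrite !inE => /andP[naL /andP[aY aA]].
(* Since [2 * (2 * r + 2) - (r + 3) = 3 * r + 1], the planes hold every point of [Y] on [A + B]. *)
have sAB : Y :&: on_flat (A + B) \subset on_flat A :|: on_flat B.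
  have eqU : (Y :&: on_flat A) :|: (Y :&: on_flat B) = Y :&: on_flat (A + B).
    apply/eqP; rewrite eqEcard -setIUr setIS ?subUset ?on_flatS ?addvSl ?addvSr //=.
    rewrite setIUr; have := cardsUI (Y :&: on_flat A) (Y :&: on_flat B).
    by rewrite -setIIr -on_flatI -/L; lia.
  by rewrite -eqU setUSS ?subsetIr.
pose M := (P + l a)%VS.
have dimM : (\dim M <= 4)%N.
  have := leq_of_leqif (dimv_add_leqif P (l a)); rewrite dim_l /M; lia.
rewrite -[4%N]/(3 + 1)%N; apply: (covered_flat _ dimM) => //.
apply: (@covered_sub_flat L 1) => //; rewrite -setD_eq0; apply/eqP.
set R := (_ :\: _) :\: _.
have cbR : flat_cb r.-2 R.
  by apply: flat_cb_excise; [lia|apply: flat_cb_excise].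
have [//|[p pR]] := set_0Vmem R.
have RAB t : t \in R -> [/\ t \in Y, ~~ (l t <= L)%VS, t != a
    & (l t <= A)%VS || (l t <= B)%VS].
  rewrite !inE => /and3P[ntL ntM tY]; split=> //.
    by apply: contraNneq ntM => ->; apply: addvSr.
  have tS : t \in Y :&: on_flat (A + B).
    rewrite !inE tY /=; apply: contraNT ntM => ntS.
    have /(subsetP sP) : t \in Y :\: on_flat (A + B) by rewrite !inE ntS.
    by rewrite inE => /subv_trans; apply; apply: addvSl.
  by have := subsetP sAB t tS; rewrite !inE.
(* [M] contains a, one of the [r - 1] points of [A] off [L]; hence the strict bound. *)
have cRA : (#|R :&: on_flat A| < r.-1)%N.
  have : (#|R :&: on_flat A| < #|(Y :&: on_flat A) :\: on_flat L|)%N.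
    apply/proper_card/properP; split.
      apply/subsetP => t; rewrite inE => /andP[/RAB[tY ntL _ _]].
      by rewrite !inE tY ntL.
    exists a; first by rewrite !inE naL aY.
    by apply/negP; rewrite inE => /andP[/RAB[_ _]]; rewrite eqxx.
  lia.
have cRB : (#|R :&: on_flat B| <= r.-1)%N.
  have : (#|R :&: on_flat B| <= #|(Y :&: on_flat B) :\: on_flat L|)%N.
    apply/subset_leq_card/subsetP => t; rewrite inE => /andP[/RAB[tY ntL _ _]].
    by rewrite !inE tY ntL.
  lia.
have cR : #|R| = (#|R :&: on_flat A| + #|R :&: on_flat B|)%N.
  rewrite -cardsUI -setIUr -setIIr -on_flatI.
  have -> : R :&: on_flat (A :&: B) = set0.
    apply/setP => t; rewrite inE [RHS]inE; apply/negP => /andP[/RAB[_ ntL _ _]].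
    by rewrite inE; apply/negP.
  rewrite cards0 addn0; congr #|pred_of_set _|; apply/esym/setIidPl/subsetP => t.
  by case/RAB => _ _ _; rewrite !inE.
(* [R] has at most [2 * r - 3] points, too few for a dense flat of dimension 2 or more, so [U] is a
   line with at least [r] of them. *)
have [e [U [dimU _ dU]]] := flat_cb_dense_dim cbR pR.
have e0 : e = 0%N by have := card_on_flatD R U; nia.
rewrite {}e0 in dimU dU.
have cU : (#|R :&: on_flat U| <= #|R :&: on_flat A :&: on_flat U|
                                 + #|R :&: on_flat B :&: on_flat U|)%N.
  rewrite -cardsUI -setIUl; apply: leq_trans (leq_addr _ _).
  apply/subset_leq_card/subsetP => t; rewrite inE => /andP[tR tU].
  by have [_ _ _] := RAB t tR; rewrite !inE in tR tU *; rewrite tR tU /= andbT.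
(* U has at least two points in B, hence lies in B and misses A off L. *)
have UB : (U <= B)%VS.
  apply: contraTT (leqnn #|R :&: on_flat B :&: on_flat U|) => nUB.
  have lt : (\dim (B :&: U) < \dim U)%N.
    rewrite (ltn_leqif (dimv_leqif_sup (capvSr _ _))); apply: contra nUB.
    by move=> /subv_trans; apply; apply: capvSl.
  have /(card_on_point R) : (\dim (B :&: U) <= 1)%N by lia.
  have := subset_leq_card (subsetIl (R :&: on_flat A) (on_flat U)).
  rewrite on_flatI setIA; lia.
(* [B] holds at most [r - 1] points of [R], fewer than [U] does. *)
have := subset_leq_card (setIS R (on_flatS UB)); lia.
Qed.

Lemma flat_cb_covered4 r Y : (0 < r)%N -> flat_cb r Y -> (#|Y| <= 5 * r + 1)%N ->
  covered 4 Y.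
Proof.
move=> r_gt0 cbY leY.
(* A flat with [4 * r + 2] points leaves none. The thresholds [3 * r + 2], [2 * r + 3] and [r + 4]
   leave at most [k * (r - 1) + 1] points for k = 2, 3, 4, as the covers of dimension 1, 2, 3
   require. *)
have [[U dimU dU]|nosolid4] :=
    flat_dec (fun S => 4 * r + 2 <= #|Y :&: S|)%N 5.
  have cardY := card_on_flatD Y U.
  apply: (covered_sub_flat _ dimU) => //.
  by apply: flat_cb_sub_flat cbY _; lia.
have [[U dimU dU]|nosolid] :=
    flat_dec (fun S => 3 * r + 2 <= #|Y :&: S|)%N 4.
  have cardY := card_on_flatD Y U.
  apply: (@covered_split U 3 1 r) => // cbZ.
  by apply: flat_cb_covered1 cbZ _; lia.
have [[U dimU dU]|noplane] :=
    flat_dec (fun S => 2 * r + 3 <= #|Y :&: S|)%N 3.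
  have cardY := card_on_flatD Y U.
  apply: (@covered_split U 2 2 r) => // cbZ.
  by apply: flat_cb_covered2 cbZ _; lia.
have [[U dimU dU]|noline] :=
    flat_dec (fun S => r + 4 <= #|Y :&: S|)%N 2.
  have cardY := card_on_flatD Y U.
  apply: (@covered_split U 1 3 r) => // cbZ.
  by apply: flat_cb_covered3 cbZ _; lia.
have dense p : p \in Y -> exists U, (l p <= U)%VS /\
    (((\dim U <= 2)%N /\ (r + 2 <= #|Y :&: on_flat U|)%N) \/
     ((\dim U <= 3)%N /\ (2 * r + 2 <= #|Y :&: on_flat U|)%N)).
  move=> pY; have [e [U [dimU pU dU]]] := flat_cb_dense_dim cbY pY.
  have cardY := card_on_flatD Y U; exists U; split=> //.
  case: e => [|e] in dimU dU *; first by left; rewrite dimU; lia.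
  case: e => [|e] in dimU dU *; first by right; rewrite dimU; lia.
  case: e => [|e] in dimU dU *.
    by have := nosolid U; rewrite dimU => /(_ isT); lia.
  case: e => [|e] in dimU dU *; last by nia.
  by have := nosolid4 U; rewrite dimU => /(_ isT); lia.
have [[A dimA dA]|noA] := flat_dec (fun S => 2 * r + 2 <= #|Y :&: S|)%N 3;
    last first.
  apply: (@covered_lines r); last lia.
  - move=> p /dense[U [pU [[dimU dU]|[dimU dU]]]]; first by exists U.
    by have := noA U dimU; lia.
  - by move=> U /noA; lia.
(* Without such a [B], the points off [A] lie on dense lines. A dense line through a point off [A]
   that met [A] in a point of [Y] would span with [A] a solid with at least [3 * r + 3] points. *)
have [[B dimB /andP[dB sB]]|noB] := flat_dec (fun S =>
    (2 * r + 2 <= #|Y :&: S|)%N && ~~ (Y :&: S \subset on_flat A)) 3; last first.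
  have cardA := card_on_flatD Y A.
  rewrite -[4%N]/(2 + 2)%N; apply: (covered_flat _ dimA) => //.
  apply: (@covered_lines r); last lia.
  - move=> p; rewrite !inE => /andP[npA pY].
    have [U [pU [[dimU dU]|[dimU dU]]]] := dense p pY; last first.
      have := noB U dimU; rewrite dU /= negbK => /subsetP/(_ p).
      by rewrite !inE pY pU (negPf npA) => /(_ isT).
    exists U; split=> //; apply: (leq_trans dU).
    apply/subset_leq_card/subsetP => t; rewrite !inE => /andP[tY tU].
    rewrite tY tU !andbT; apply/negP => tA.
    have ltAU := dim_join_meet tA tU; have ltU := dim_cap_proper pU npA.
    have := @card_on_join Y A U.
    have /(card_on_point Y) : (\dim (A :&: U) <= 1)%N by lia.
    have /nosolid : (\dim (A + U) <= 4)%N by lia.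
    lia.
  - move=> U dimU; have := noplane U dimU.
    have := subset_leq_card (setSI (on_flat U) (subsetDl Y (on_flat A))); lia.
have /subsetPn[b] := sB; rewrite !inE => /andP[bY bB] nbA.
have ltL := dim_cap_proper bB nbA; have := @card_on_join Y A B.
have := card_on_flatD Y A.
have := card_on_flatD (Y :\: on_flat A) B.
have dimL : (\dim (A :&: B) <= 2)%N by lia.
have := noplane A dimA; have := noplane B dimB; have := noline _ dimL.
(* If the meet holds at most 2 points, [A] and [B] hold at least [4 * r + 2], and the at most
   [r - 1] others cannot exist. *)
have [small|big] := leqP #|Y :&: on_flat (A :&: B)| 2.
  move=> _ nB nA cB cA _; rewrite -[4%N]/(2 + 2)%N.
  have cbA : flat_cb r.-1 (Y :\: on_flat A) by apply: flat_cb_excise.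
  apply: (covered_flat _ dimA) => //; apply: (covered_sub_flat _ dimB) => //.
  have cBD : #|Y :&: on_flat B| =
     (#|Y :&: on_flat (A :&: B)| + #|(Y :\: on_flat A) :&: on_flat B|)%N.
    rewrite -(cardsID (on_flat A) (Y :&: on_flat B)) on_flatI -setIA.
    by rewrite (setIC (on_flat B)) setIDAC.
  have [r1|r_gt1] := leqP r 1.
    by rewrite -setD_eq0 -cards_eq0; lia.
  by apply: flat_cb_sub_flat cbA _; lia.
have dimL2 : (2 <= \dim (A :&: B))%N.
  rewrite leqNgt; apply/negP; rewrite ltnS => /(card_on_point Y); lia.
have dimS : (\dim (A + B) <= 4)%N by have := dimv_sum_cap A B; lia.
(* The bounds [r + 3] on the meet, [3 * r + 1] on the join and [2 * r + 2] on the planes turn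
   [card_on_join] into an equality, so all are attained. *)
move=> nL nB nA _ _ leS; have := nosolid _ dimS => nS.
have cA := card_on_flatD Y (A :&: B)%VS.
(* For [r = 1] the line [A :&: B] has 4 of at most 6 points, and a second line takes the rest. *)
have [r1|r_gt1] := leqP r 1; last by apply: (@flat_cb_two_planes r Y A B) => //; lia.
apply: (@covered_le 2) => //; apply: (covered_flat _ dimL) => //.
apply: (@covered_sub_flat (flat_span (Y :\: on_flat (A :&: B))) 1) => //.
  by apply: leq_trans (dim_flat_span _) _; lia.
by apply/subsetP => t tD; rewrite inE sub_flat_span.
Qed.

End PointConfigurations.

(** * Hypersurfaces and plane configurations *)

Section Hypersurfaces.

Variables (K : fieldType) (n : nat).
Implicit Types (U : {vspace 'rV[K]_n.+1}) (v x : 'rV[K]_n.+1).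

Lemma separating_form U v : v \notin U -> exists F : {mpoly K[n.+1]},
  [/\ F \is 1.-homog, F.@[v 0] != 0 & forall x, x \in U -> F.@[x 0] = 0].
Proof.
(* [phi] is a projection with kernel [U]; a coordinate of it that is nonzero at [v] is the form. *)
move=> nvU; pose phi := (\1 - projv U)%VF.
have phiE x : phi x = x - projv U x by rewrite add_lfunE opp_lfunE id_lfunE.
have [j nz] : exists j, phi v 0 j != 0.
  apply/existsP; apply: contraNT nvU => /existsPn z.
  have -> : v = projv U v; last exact: memv_proj.
  apply/eqP; rewrite -subr_eq0; apply/eqP/rowP => j; rewrite [RHS]mxE.
  by have := z j; rewrite negbK phiE => /eqP.
pose F : {mpoly K[n.+1]} := \sum_i phi (delta_mx 0 i) 0 j *: 'X_i.
have evalF x : F.@[x 0] = phi x 0 j.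
  rewrite [X in phi X](row_sum_delta x) [phi _]linear_sum summxE /F raddf_sum.
  by apply: eq_bigr => i _; rewrite /= mevalZ mevalXU linearZ mxE mulrC.
exists F; split; rewrite ?evalF //.
  by apply: rpred_sum => i _; rewrite rpredZ // dhomogX; apply/eqP; apply: mdeg1.
by move=> x xU; rewrite evalF phiE projv_id // subrr mxE.
Qed.

Lemma separating_product (s : seq {vspace 'rV[K]_n.+1}) v :
  (forall U, U \in s -> v \notin U) -> exists F : {mpoly K[n.+1]},
  [/\ F \is (size s).-homog, F.@[v 0] != 0
    & forall U x, U \in s -> x \in U -> F.@[x 0] = 0].
Proof.
elim: s => [|U s IH] nvs.
  exists 1; split=> //; first exact: dhomog1.
  by rewrite meval1 oner_eq0.
have [|F [homF Fv Fs]] := IH; first by move=> W Ws; rewrite nvs // inE Ws orbT.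
have [|G [homG Gv GU]] := @separating_form U v; first by rewrite nvs ?mem_head.
exists (G * F); split.
- exact: (dhomogM homG homF).
- by rewrite mevalM mulf_neq0.
move=> W x; rewrite inE mevalM => /orP[/eqP -> /GU ->|Ws /(Fs _ _ Ws) ->].
  by rewrite mul0r.
by rewrite mulr0.
Qed.

Lemma point_line (p : point K n) : exists2 v, v != 0 & val p = <[v]>%VS.
Proof.
exists (vpick (val p)).
  by rewrite vpick0 -dimv_eq0; case: p => p /= /eqP ->.
apply/eqP; rewrite eq_sym eqEdim -memvE memv_pick dim_vline vpick0 -dimv_eq0.
by case: p => p /= /eqP ->.
Qed.

Lemma cayley_bacharach_flat_cb r (X : {fset point K n}) :
  cayley_bacharach r X -> flat_cb (fun t : X => val (val t)) r [set: X].
Proof.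
move=> X_CB p _ s sz cov; apply/negPn/negP => /hasPn ns.
have [v nz_v pv] := point_line (val p).
(* Zero spaces bring the degree to exactly [r]: each contributes a linear form nonzero at [v]. *)
pose s' := s ++ nseq (r - size s) 0%VS.
have sz' : size s' = r by rewrite size_cat size_nseq subnKC.
have [U|F [homF Fv Fs]] := @separating_product s' v.
  rewrite mem_cat mem_nseq => /orP[/ns|/andP[_ /eqP ->]].
    by rewrite /= pv -memvE.
  by rewrite memv0.
rewrite sz' in homF.
have nzF : F != 0 by apply: contraNneq Fv => ->; rewrite meval0.
case/eqP: Fv; apply: (X_CB F _ (val p) (valP p) _ (val p) (valP p)) => //.
  move=> q qX qp x xq _.
  have /hasP[U Us qU] := cov [` qX]%fset (in_setT _) qp.
  by apply: (Fs U); rewrite ?mem_cat ?Us //; apply: subvP qU _ xq.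
by rewrite pv memv_line.
Qed.

(** A supply of lines for filling configurations up to the exact dimension: they join [e 2] to the
    points [e 0 + c e 1], which are distinct in characteristic zero. *)
Lemma distinct_lines : [pchar K] =i pred0 -> (1 < n)%N ->
  exists2 f : nat -> linear_space K n, injective f & forall i, pdim (f i) = 1%N.
Proof.
move=> charK n_gt1.
have natr_inj (c d : nat) : c%:R = d%:R :> K -> c = d.
  wlog le_dc : c d / (d <= c)%N.
    by move=> IH eq_cd; case/orP: (leq_total d c) => /IH; [apply|move=> ->].
  move/eqP; rewrite -subr_eq0 -natrB //.
  move/pcharf0P: charK => ->; rewrite subn_eq0 => ge.
  by apply/eqP; rewrite eqn_leq ge.
pose e (k : nat) : 'rV[K]_n.+1 := delta_mx 0 (inord k).
pose w (c : nat) := e 0%N + c%:R *: e 1%N.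
have eE (i j : nat) : (i <= 2)%N -> (j <= 2)%N -> e i 0 (inord j) = (i == j)%:R.
  move=> ile jle; rewrite mxE eqxx /= -val_eqE /= !inordK; [|lia|lia].
  by rewrite eq_sym.
have wE (c j : nat) : (j <= 2)%N ->
    w c 0 (inord j) = (j == 0%N)%:R + c%:R * (j == 1%N)%:R.
  by move=> jle; rewrite mxE [X in _ + X]mxE !eE // ![_ == j]eq_sym.
exists (fun c => (<[w c]> + <[e 2%N]>)%VS) => [c d eq_cd|c].
  have : w c \in (<[w d]> + <[e 2%N]>)%VS.
    by rewrite -eq_cd; apply: subvP (addvSl _ _) _ (memv_line _).
  case/memv_addP => _ /vlineP[a ->] [_ /vlineP[b ->]] /rowP eqw.
  have := eqw (inord 1); have := eqw (inord 0).
  rewrite !(wE, eE, mxE) //= !(mulr0, mulr1, addr0, add0r) => <-.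
  rewrite mul1r; exact: natr_inj.
have nz_w : w c != 0.
  apply/eqP => /rowP/(_ (inord 0)); rewrite wE // mxE mulr0 addr0.
  exact/eqP/oner_neq0.
suff dim2 : \dim (<[w c]> + <[e 2%N]>) = 2%N by rewrite /pdim dim2.
have := leq_of_leqif (dimv_add_leqif <[w c]> <[e 2%N]>).
have : (\dim <[w c]> < \dim (<[w c]> + <[e 2%N]>))%N.
  rewrite (ltn_leqif (dimv_leqif_sup (addvSl _ _))) subv_add subvv /= -memvE.
  apply/negP => /vlineP[a /rowP eqe].
  have := eqe (inord 0); have := eqe (inord 2).
  rewrite !(wE, eE, mxE) //= !(mulr0, mulr1, addr0, add0r) => /eqP.
  by rewrite oner_eq0.
by rewrite !dim_vline nz_w; case: (e _ != 0); lia.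
Qed.

Local Open Scope fset_scope.

Lemma exact_configuration d (s : seq {vspace 'rV[K]_n.+1}) :
  [pchar K] =i pred0 -> (1 < n)%N ->
  all (fun U => 1 < \dim U)%N s -> (\sum_(U <- s) (\dim U).-1 <= d)%N ->
  exists P : {fset linear_space K n},
    [/\ plane_configuration P, config_dim P = d & {subset s <= P}].
Proof.
move=> charK n_gt1 /allP s_gt1 le_d.
have [P] : exists P : {fset linear_space K n},
    [/\ plane_configuration P, (config_dim P <= d)%N & {subset s <= P}].
  elim: s s_gt1 d le_d => [|U s IH] s_gt1 d.
    by exists fset0; split=> //; rewrite /config_dim big_seq_fset0.
  rewrite big_cons => le_d.
  have [|P [confP leP sP]] := IH _ _ (leqnn _).
    by move=> W Ws; rewrite s_gt1 // inE Ws orbT.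
  have [UP|nUP] := boolP (U \in P).
    exists P; split=> //.
      exact: leq_trans leP (leq_trans (leq_addl _ _) le_d).
    by move=> W; rewrite inE => /orP[/eqP ->|/sP].
  exists (U |` P); split.
  - move=> W; rewrite !inE => /orP[/eqP ->|/confP //].
    by rewrite /pdim; have := s_gt1 U (mem_head _ _); lia.
  - by apply: leq_trans le_d; rewrite /config_dim big_fsetU1 //= leq_add2l.
  - by move=> W; rewrite !inE => /orP[->//|/sP ->]; rewrite orbT.
have [f f_inj f_line] := distinct_lines charK n_gt1.
have [m] := ubnP (d - config_dim P)%N; elim: m P => // m IH P lt [confP leP sP].
have [eqd|ned] := eqVneq (config_dim P) d; first by exists P.
have [i fiP] : exists i, f i \notin P.
  suff /hasP[i _ fiP] : has (fun i => f i \notin P) (iota 0 #|` P|.+1).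
    by exists i.
  rewrite -[has _ _]negbK -all_predC; apply/allP => fP.
  have : (size (map f (iota 0 #|` P|.+1)) <= #|` P|)%N.
    apply: uniq_leq_size; first by rewrite map_inj_uniq ?iota_uniq.
    by move=> _ /mapP[i /fP /= /negPn fiP ->].
  by rewrite size_map size_iota ltnn.
have dimP : config_dim (f i |` P) = (config_dim P).+1.
  by rewrite /config_dim big_fsetU1 //= f_line.
apply: (IH (f i |` P)); first by rewrite dimP; lia.
split; first last.
- by move=> U /sP; rewrite !inE orbC => ->.
- by rewrite dimP; lia.
by move=> L; rewrite !inE => /orP[/eqP ->|/confP]; rewrite ?f_line.
Qed.

End Hypersurfaces.

Local Open Scope fset_scope.

(* In P^0 and P^1 the positive-dimensional linear spaces have total dimension
   at most 1, so no plane configuration of dimension 4 exists there, whereas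
   e.g. r + 2 points of P^1 satisfy all the other hypotheses; hence 1 < n. *)
Theorem theorem1p4 (K : fieldType) (charK : [pchar K] =i pred0)
    (n : nat) (n_gt1 : (1 < n)%N) (r : nat) (r_ge1 : (1 <= r)%N)
    (X : {fset point K n}) (X_CB : cayley_bacharach r X)
    (X_le : (#|` X| <= 5 * r + 1)%N) :
  exists P : {fset linear_space K n},
    [/\ plane_configuration P, config_dim P = 4%N & lies_on X P].
Proof.
have l_inj : injective (fun t : X => val (val t)).
  by move=> s t /val_inj/val_inj.
have dim_l (t : X) : \dim (val (val t)) = 1%N.
  by case: t => [[U dimU] /= _]; apply/eqP.
have dimV : (1 < \dim {:'rV[K]_n.+1})%N.
  by rewrite dimvf /dim /= mul1n; lia.
have [|s [s_gt1 sum_s cov]] :=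
    @flat_cb_covered4 _ _ _ _ l_inj dim_l dimV r _ r_ge1
      (cayley_bacharach_flat_cb X_CB).
  by rewrite cardsT -cardfE.
have [P [confP dimP sP]] := exact_configuration charK n_gt1 s_gt1 sum_s.
exists P; split=> // p pX.
have /hasP[U Us pU] := cov [` pX] (in_setT _).
by exists U; first exact: sP.
Qed.
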